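(* Let $K$ be a finite-dimensional compact abelian group and let $G$ be a dense subgroup of $K$. Then the following are equivalent: (a) $G$ is locally minimal; (b) $G\cap N$ is locally essential in $N$ for some $N\in\mathcal{N}_K$; (c) $G\cap N$ is locally essential in $N$ for all $N\in\mathcal{N}_K$.
   Context: Compact groups are Hausdorff; subgroups carry the subspace topology; $\mathbb{T}=\mathbb{R}/\mathbb{Z}$. For a finite-dimensional compact abelian group $K$ with $d=\dim K$ (equivalently, the Pontryagin dual of $K$ has free rank $d$), $\mathcal{N}_K$ denotes the family of all closed subgroups $N$ of $K$ such that $K/N$ is topologically isomorphic to $\mathbb{T}^d$. A Hausdorff topological group $(G,\tau)$ is locally minimal if there exists a neighborhood $V$ of $0$ such that whenever $\sigma\subseteq\tau$ is a Hausdorff group topology on $G$ for which $V$ is a $\sigma$-neighborhood of $0$, then $\sigma=\tau$. A subgroup $H$ of a topological abelian group $L$ is locally essential in $L$ if there exists a neighborhood $V$ of $0$ in $L$ such that for every closed subgroup $M$ of $L$ contained in $V$, $H\cap M=\{0\}$ implies $M=\{0\}$. *)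

(* Defs.v *)
From HB Require Import structures.
From mathcomp Require Import all_boot all_order all_algebra.
From mathcomp Require Import all_classical all_reals all_analysis.

Set Implicit Arguments.
Unset Strict Implicit.
Unset Printing Implicit Defensive.

Import GRing.Theory Num.Theory.
Import numFieldNormedType.Exports.

Local Open Scope classical_set_scope.
Local Open Scope ring_scope.

Lemma continuous_sub (T : topologicalType) (V : topologicalZmodType)
    (f g : T -> V) :
  continuous f -> continuous g -> continuous (fun x => f x - g x).
Proof.
move=> fc gc x; apply: (@continuous_comp T (V * V)%type V
  (fun x => (f x, g x)) (fun q => q.1 - q.2)); last exact: sub_continuous.
by apply: cvg_pair; [exact: fc|exact: gc].
Qed.

(* A subgroup of [V] is a bundled [S : zmodClosed V]; [subgroup S] is the
   corresponding group, with the subspace topology when [V] is topological. *)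
Definition subgroup (V : zmodType) (S : zmodClosed V) : Type :=
  {x : V | x \in S}.

HB.instance Definition _ (V : zmodType) (S : zmodClosed V) :=
  [isSub of subgroup S for @sval V (fun x => x \in S)].
HB.instance Definition _ (V : zmodType) (S : zmodClosed V) :=
  [Choice of subgroup S by <:].
HB.instance Definition _ (V : zmodType) (S : zmodClosed V) :=
  [SubChoice_isSubZmodule of subgroup S by <:].

Section SubgroupTopology.
Variables (V : topologicalZmodType) (S : zmodClosed V).

HB.instance Definition _ :=
  Topological.copy (subgroup S) (initial_topology (\val : subgroup S -> V)).

Lemma subgroup_sub_continuous :
  continuous (fun p : subgroup S * subgroup S => p.1 - p.2).
Proof.
have valc : continuous (\val : subgroup S -> V) by exact: initial_continuous.
move=> p B [_ [[A oA <-] Ap] AB]; apply: (filterS AB).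
have : continuous (fun q : subgroup S * subgroup S => \val q.1 - \val q.2).
  apply: continuous_sub => q; apply: continuous_comp;
    [exact: cvg_fst|exact: valc|exact: cvg_snd|exact: valc].
move=> /(_ p A); apply; apply: open_nbhs_nbhs; split => //.
Qed.

HB.instance Definition _ :=
  PreTopologicalNmodule_isTopologicalZmodule.Build (subgroup S)
    subgroup_sub_continuous.

End SubgroupTopology.

(* [quotient_group S] is V / S, with the quotient topology when [V] is
   topological. *)
Definition quotient_group (V : zmodType) (S : zmodClosed V) : Type :=
  Quotient.quot S.

HB.instance Definition _ (V : zmodType) (S : zmodClosed V) :=
  GRing.Zmodule.on (quotient_group S).
HB.instance Definition _ (V : zmodType) (S : zmodClosed V) :=
  Quotient.on (quotient_group S).

Section QuotientTopology.
Variables (V : topologicalZmodType) (S : zmodClosed V).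

Let proj (x : V) : quotient_group S := \pi_(Quotient.quot S)%qT x.

Definition quotient_group_open : set_system (quotient_group S) :=
  [set U | open (proj @^-1` U)].

Let quotient_group_openT : quotient_group_open setT.
Proof. exact: openT. Qed.

Let quotient_group_openI : setI_closed quotient_group_open.
Proof. by move=> A B; exact: openI. Qed.

Let quotient_group_open_bigcup (I : Type) (f : I -> set (quotient_group S)) :
  (forall i, quotient_group_open (f i)) -> quotient_group_open (\bigcup_i f i).
Proof. by move=> fo; apply: bigcup_open => i _; exact: fo. Qed.

HB.instance Definition _ := isOpenTopological.Build (quotient_group S)
  quotient_group_openT quotient_group_openI quotient_group_open_bigcup.

Let projE (x y : V) : (proj x = proj y) <-> (x - y \in S).
Proof. by rewrite Quotient.idealrBE; split=> [/eqP|/eqP]. Qed.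

Let projB (x y : V) : proj (x - y) = proj x - proj y.
Proof. exact: (raddfB (\pi_(Quotient.quot S)%qT)). Qed.

Let proj_open (A : set V) : open A -> open (proj @` A).
Proof.
move=> oA; change (open (proj @^-1` (proj @` A))).
have -> : proj @^-1` (proj @` A) =
    \bigcup_(s in [set` S]) ((fun x => x - s) @^-1` A).
  rewrite eqEsubset; split => x /=.
    move=> [a Aa /projE] aS; exists (x - a) => /=; last by rewrite subKr.
    by rewrite -opprB rpredN.
  move=> [s /= sS Axs]; exists (x - s) => //; apply/projE.
  by rewrite addrC addKr rpredN.
apply: bigcup_open => s _; apply: open_comp => // x _.
by apply: (@continuous_sub V V id (cst s)) => y; [exact: cvg_id|exact: cvg_cst].
Qed.

Lemma quotient_sub_continuous :
  continuous (fun p : quotient_group S * quotient_group S => p.1 - p.2).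
Proof.
move=> [a b] W nW.
have [U [oU Uab] UW] : exists2 U, open_nbhs (a - b) U & U `<=` W.
  by move: nW; rewrite nbhsE.
have [x xa] : exists x, proj x = a by exists (repr a); exact: reprK.
have [y yb] : exists x, proj x = b by exists (repr b); exact: reprK.
have oU' : open (proj @^-1` U) by exact: oU.
have : nbhs (x - y) (proj @^-1` U).
  apply: open_nbhs_nbhs; split => //=.
  by rewrite /= projB xa yb.
move=> /(@sub_continuous V (x, y)) [[A B] /= [nA nB] ABU].
move: nA nB; rewrite (nbhsE x) (nbhsE y).
move=> -[A' [oA' A'x] AA'] [B' [oB' B'y] BB'].
exists (proj @` A', proj @` B').
  split; apply: open_nbhs_nbhs; split => /=.
  - exact: proj_open.
  - by exists x.
  - exact: proj_open.
  - by exists y.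
move=> [_ _] /= [[u A'u <-] [v B'v <-]]; apply: UW; rewrite -projB.
by apply: (ABU (u, v)); split => /=; [exact: AA'|exact: BB'].
Qed.

HB.instance Definition _ :=
  PreTopologicalNmodule_isTopologicalZmodule.Build (quotient_group S)
    quotient_sub_continuous.

End QuotientTopology.

Section Circle.
Variable R : realType.

Definition integers : {pred R} := fun x => x \is a Num.int.

Lemma integers_zmod_closed : zmod_closed integers.
Proof. by split=> [|x y xZ yZ]; [exact: rpred0|exact: rpredB]. Qed.

HB.instance Definition _ :=
  GRing.isZmodClosed.Build R integers integers_zmod_closed.

Definition circle : topologicalZmodType := quotient_group integers.

End Circle.

Lemma mx_sub_continuous (V : topologicalZmodType) (m n : nat) :
  continuous (fun p : 'M[V]_(m, n) * 'M[V]_(m, n) => p.1 - p.2).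
Proof.
move=> [a b] W [P nP PW].
have /choice [Q nQ] (k : 'I_m * 'I_n) : exists Q : set V * set V,
    [/\ nbhs (a k.1 k.2) Q.1, nbhs (b k.1 k.2) Q.2 &
        forall x y, Q.1 x -> Q.2 y -> P k.1 k.2 (x - y)].
  have := nP k.1 k.2; rewrite !mxE.
  move=> /(@sub_continuous V (a k.1 k.2, b k.1 k.2)) [Q [Q1 Q2] QP].
  by exists Q; split => // x y Qx Qy; apply: (QP (x, y)); split.
exists ([set M : 'M[V]_(m, n) | forall i j, (Q (i, j)).1 (M i j)],
        [set M : 'M[V]_(m, n) | forall i j, (Q (i, j)).2 (M i j)]).
  split.
    by exists (fun i j => (Q (i, j)).1) => // i j; have [] := nQ (i, j).
  by exists (fun i j => (Q (i, j)).2) => // i j; have [] := nQ (i, j).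
move=> [x y] /= [xQ yQ]; apply: PW => i j; rewrite !mxE.
by have [_ _] := nQ (i, j); apply; [exact: xQ|exact: yQ].
Qed.

Definition torus (R : realType) (d : nat) : Type := 'rV[circle R]_d.

HB.instance Definition _ (R : realType) (d : nat) :=
  GRing.Zmodule.copy (torus R d) 'rV[circle R]_d.
HB.instance Definition _ (R : realType) (d : nat) :=
  Topological.copy (torus R d) 'rV[circle R]_d.
HB.instance Definition _ (R : realType) (d : nat) :=
  PreTopologicalNmodule_isTopologicalZmodule.Build (torus R d)
    (@mx_sub_continuous (circle R) 1 d).

Definition topologically_isomorphic (A B : topologicalZmodType) : Prop :=
  exists (f : {additive A -> B}) (g : B -> A),
    [/\ cancel f g, cancel g f, continuous f & continuous g].

Section Dual.
Variables (R : realType) (K : topologicalZmodType).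

Definition character : {pred K -> circle R} :=
  fun f => `[< zmod_morphism f /\ continuous f >].

Lemma character_zmod_closed : zmod_closed character.
Proof.
split=> [|f g /asboolP[fB fc] /asboolP[gB gc]]; apply/asboolP; split.
- by move=> x y; rewrite /= subrr.
- by move=> x; exact: cvg_cst.
- move=> x y; change (f (x - y) - g (x - y) = f x - g x - (f y - g y)).
  by rewrite fB gB !opprD !addrA; congr (_ + _); rewrite addrAC.
- exact: continuous_sub.
Qed.

HB.instance Definition _ :=
  GRing.isZmodClosed.Build (K -> circle R) character character_zmod_closed.

(* The Pontryagin dual as an abstract group; its compact-open topology (discrete
   when [K] is compact) plays no role for the free rank. *)
Definition dual : zmodType := subgroup character.

End Dual.

Definition zindependent (A : zmodType) (n : nat) (e : 'I_n -> A) : Prop :=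
  forall c : 'I_n -> int, \sum_i e i *~ c i = 0 -> forall i, c i = 0.

Definition free_rank (A : zmodType) (d : nat) : Prop :=
  (exists e : 'I_d -> A, zindependent e) /\
  (forall n (e : 'I_n -> A), zindependent e -> (n <= d)%N).

(* dim K = d for compact abelian K, as the free rank of the Pontryagin dual. *)
Definition has_dim (R : realType) (K : topologicalZmodType) (d : nat) : Prop :=
  free_rank (dual R K) d.

(* The closed subgroups N with K / N ≅ T^d; this is the family N_K when
   [has_dim R K d]. *)
Definition torus_quotient_subgroups (R : realType) (K : topologicalZmodType)
    (d : nat) : set (zmodClosed K) :=
  [set N : zmodClosed K | closed [set` N] /\
     topologically_isomorphic (quotient_group N) (torus R d)].
Arguments torus_quotient_subgroups R K d : clear implicits.

(* A topology on [T] as a family of open sets, so that several topologies on the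
   same type can be compared. *)
Record topology_on (T : Type) := TopologyOn {
  opens :> set_system T ;
  opensT : opens setT ;
  opensI : setI_closed opens ;
  opens_bigcup : forall (I : Type) (f : I -> set T),
    (forall i, opens (f i)) -> opens (\bigcup_i f i)
}.

Definition with_topology (T : Type) (sigma : topology_on T) : Type := T.

HB.instance Definition _ (L : zmodType) (sigma : topology_on L) :=
  GRing.Zmodule.copy (with_topology sigma) L.
HB.instance Definition _ (L : zmodType) (sigma : topology_on L) :=
  isOpenTopological.Build (with_topology sigma)
    (opensT sigma) (@opensI _ sigma) (@opens_bigcup _ sigma).

Definition group_topology (L : zmodType) (sigma : topology_on L) : Prop :=
  continuous (fun p : with_topology sigma * with_topology sigma => p.1 - p.2).

Definition locally_minimal (L : topologicalZmodType) : Prop :=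
  hausdorff_space L /\
  exists2 V : set L, nbhs 0 V &
    forall sigma : topology_on L,
      (sigma : set_system L) `<=` open ->
      group_topology sigma ->
      hausdorff_space (with_topology sigma) ->
      nbhs (0 : with_topology sigma) V ->
      (sigma : set_system L) = open.

Definition locally_essential (L : topologicalZmodType) (H : zmodClosed L) :
    Prop :=
  exists2 V : set L, nbhs 0 V &
    forall M : zmodClosed L, closed [set` M] -> [set` M] `<=` V ->
      [set` H] `&` [set` M] = [set 0] -> [set` M] = [set 0].

Section Trace.
Variables (K : zmodType) (G N : zmodClosed K).

(* The subgroup G ∩ N of N. *)
Definition trace : {pred subgroup N} := fun x => \val x \in G.

Lemma trace_zmod_closed : zmod_closed trace.
Proof.
split=> [|x y xG yG]; rewrite /trace unfold_in ?raddf0 ?raddfB ?rpred0//.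
exact: rpredB.
Qed.

HB.instance Definition _ :=
  GRing.isZmodClosed.Build (subgroup N) trace trace_zmod_closed.

End Trace.

Arguments trace {K} G N.

(* Main.v *)
Require Import Defs.
From HB Require Import structures.
From mathcomp Require Import all_boot all_order all_algebra.
From mathcomp Require Import all_classical all_reals all_analysis.
From mathcomp Require Import lra.

(* A dense subgroup G of a compact group K is locally minimal iff it is locally
   essential in K. If G is locally minimal and M is a small closed subgroup with
   G ∩ M = 0, then G -> K / M induces on G a coarser Hausdorff group topology,
   which must be the original one, and density forces M = 0. Conversely, for a
   coarser Hausdorff group topology on G, the intersection M of the closures in
   K of its neighborhoods of 0 is a closed subgroup with G ∩ M = 0; it is small,
   hence trivial, and compactness makes the two topologies equal.

   Since T^d has no small subgroups, a small closed subgroup of K lies in N as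
   soon as K / N ≅ T^d; so G is locally essential in K iff G ∩ N is so in N.

   Finally N_K is not empty: d independent characters of K map K onto T^d. By
   induction, let chi_0 be restricted to the common kernel of the other ones.
   Its image is a closed subgroup of T, so it is T or is killed by some m > 0.
   In the second case m chi_0 factors through a continuous homomorphism
   T^(d-1) -> T, which is an integer combination of the coordinates, contrary
   to independence. *)

Set Implicit Arguments.
Unset Strict Implicit.
Unset Printing Implicit Defensive.

Import Order.TTheory GRing.Theory Num.Theory.
Import numFieldNormedType.Exports.

Local Open Scope classical_set_scope.
Local Open Scope ring_scope.

(** * Topological groups *)

Lemma nbhs_preimage (T U : topologicalType) (f : T -> U) x (B : set U) :
  continuous f -> nbhs (f x) B -> nbhs x (f @^-1` B).
Proof. by move=> /(_ x B). Qed.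

Section TopologicalGroups.
Variable V : topologicalZmodType.
Implicit Types (A B : set V) (x y : V).

Lemma nbhs0_sub A :
  nbhs 0 A -> exists2 B, nbhs 0 B & forall x y, B x -> B y -> A (x - y).
Proof.
rewrite -{1}(subr0 (0 : V)) => /(@sub_continuous V (0, 0))[[B C] /= [nB nC] BC].
by exists (B `&` C) => [|x y [Bx _] [_ Cy]]; [exact: filterI|exact: (BC (x, y))].
Qed.

Lemma subr_continuous z : continuous (fun y : V => y - z).
Proof. by apply: continuous_sub => y; [exact: cvg_id|exact: cvg_cst]. Qed.

Lemma nbhs_shift x A : nbhs x A <-> nbhs 0 [set y | A (y + x)].
Proof.
split=> nA.
  have := @nbhs_preimage _ _ _ 0 A (@subr_continuous (- x)).
  by rewrite opprK add0r => /(_ nA).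
have := @nbhs_preimage _ _ _ x _ (@subr_continuous x); rewrite subrr => /(_ _ nA).
by apply: filterS => y /=; rewrite subrK.
Qed.

Lemma closureP_shift A x :
  closure A x <-> forall B, nbhs 0 B -> exists2 a, A a & B (a - x).
Proof.
split=> [Ax B nB|Ax B /nbhs_shift/Ax[a Aa]]; last first.
  by rewrite /= subrK => Ba; exists a.
have [|a [Aa Ba]] := Ax [set y | B (y - x)]; last by exists a.
apply/nbhs_shift; apply: filterS nB => y By /=; by rewrite addrK.
Qed.

Lemma hausdorff_nbhs0 :
  (forall x, (forall A, nbhs 0 A -> A x) -> x = 0) -> hausdorff_space V.
Proof.
move=> V0 x y xy; apply/eqP; rewrite -subr_eq0; apply/eqP/V0 => A.
move=> /nbhs0_sub[B nB BA].
have nBz z : nbhs z [set t | B (z - t)].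
  apply: (@nbhs_preimage _ _ (fun t => z - t)); last by rewrite subrr.
  by apply: continuous_sub => t; [exact: cvg_cst|exact: cvg_id].
have [z [Bx By]] := xy _ _ (nBz x) (nBz y).
have -> : x - y = (x - z) - (y - z) by rewrite opprB addrA subrK.
exact: BA.
Qed.

End TopologicalGroups.

Lemma zmodClosed_of_set (V : zmodType) (A : set V) :
  A 0 -> (forall x y, A x -> A y -> A (x - y)) ->
  exists S : zmodClosed V, [set` S] = A.
Proof.
move=> A0 AB.
pose p : {pred V} := fun x => `[< A x >].
have pB : zmod_closed p.
  by split=> [|x y /asboolP Ax /asboolP Ay]; apply/asboolP; [|exact: AB].
pose S : zmodClosed V := HB.pack p (GRing.isZmodClosed.Build V p pB).
exists S; apply/seteqP; split=> x /=; first by move/asboolP.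
by move=> Ax; apply/asboolP.
Qed.

(** Packages [sigma] as a topological group, so that the lemmas on neighborhoods of 0 apply to it
    too. *)
Definition topologicalZmod_of (L : zmodType) (sigma : topology_on L)
  (Hs : group_topology sigma) : topologicalZmodType :=
  HB.pack (with_topology sigma)
   (PreTopologicalNmodule_isTopologicalZmodule.Build (with_topology sigma) Hs).

(** Translations reduce the comparison of group topologies to their neighborhoods of 0. *)
Lemma group_topology_eq (L : topologicalZmodType) (sigma : topology_on L) :
  (sigma : set_system L) `<=` open -> group_topology sigma ->
  (forall U : set L, nbhs 0 U -> nbhs (0 : with_topology sigma) U) ->
  (sigma : set_system L) = open.
Proof.
move=> sub gs fine; apply/seteqP; split=> // U oU.
suff : @open (with_topology sigma) U by [].
rewrite openE => x Ux.
apply/(@nbhs_shift (topologicalZmod_of gs)); apply: fine.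
by apply: (@nbhs_shift L x U).1; exact: open_nbhs_nbhs.
Qed.

(** * Topologies induced by homomorphisms *)

Section InducedTopology.
Variables (L : zmodType) (W : topologicalZmodType) (f : {additive L -> W}).

Definition induced_topology : topology_on L.
Proof.
exists [set U | exists2 O : set W, open O & f @^-1` O = U].
- by exists setT; [exact: openT|].
- by move=> _ _ [A oA <-] [B oB <-]; exists (A `&` B); [exact: openI|].
- move=> I U oU; have /choice[P oP] i : exists P, open P /\ f @^-1` P = U i.
    by have [P oP eP] := oU i; exists P.
  exists (\bigcup_i P i); first by apply: bigcup_open => i _; have [] := oP i.
  by rewrite preimage_bigcup; apply: eq_bigcupr => i _; have [] := oP i.
Defined.

Lemma nbhs_induced x (U : set L) :
  nbhs (x : with_topology induced_topology) U <->
  exists2 Q, nbhs (f x) Q & f @^-1` Q `<=` U.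
Proof.
rewrite nbhsE; split=> [[_ [[Q oO <-] Qfx] QU]|[Q]].
  by exists Q => //; exact: open_nbhs_nbhs.
rewrite nbhsE => -[P [oP Pfx] PO] QU; exists (f @^-1` P); last first.
  by apply: subset_trans QU => y /PO.
by split=> //; exists P.
Qed.

Lemma induced_group_topology : group_topology induced_topology.
Proof.
move=> [x y] U /nbhs_induced[Q]; rewrite /= raddfB.
move=> /(@sub_continuous W (f x, f y))[[A B] /= [nA nB] AB] QU.
exists (f @^-1` A, f @^-1` B).
  by split; apply/nbhs_induced; [exists A|exists B].
by move=> [a b] /= [Aa Bb]; apply: QU; rewrite /= raddfB; exact: (AB (f a, f b)).
Qed.

Lemma induced_hausdorff :
  injective f -> hausdorff_space W ->
  hausdorff_space (with_topology induced_topology).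
Proof.
move=> fI hW x y xy; apply: fI; apply: hW => A B nA nB.
have [|| z [Az Bz]] := xy (f @^-1` A) (f @^-1` B).
- by apply/nbhs_induced; exists A.
- by apply/nbhs_induced; exists B.
by exists (f z).
Qed.

End InducedTopology.

(** * Quotients and dense subgroups *)

Section Quotient.
Variables (V : topologicalZmodType) (S : zmodClosed V).

Definition quotient_proj : {additive V -> quotient_group S} :=
  (\pi_(Quotient.quot S)%qT : {additive V -> Quotient.quot S}).

Lemma quotient_projE x y : quotient_proj x = quotient_proj y <-> x - y \in S.
Proof. by rewrite Quotient.idealrBE; split=> [/eqP|/eqP]. Qed.

Lemma quotient_proj_eq0 x : quotient_proj x = 0 <-> x \in S.
Proof. by rewrite -(raddf0 quotient_proj) quotient_projE subr0. Qed.

Lemma quotient_proj_surj a : exists x, quotient_proj x = a.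
Proof. by exists (repr a); exact: reprK. Qed.

Lemma quotient_proj_continuous : continuous quotient_proj.
Proof. by apply/continuousP => A. Qed.

Lemma quotient_proj_nbhs x (A : set V) :
  nbhs x A -> nbhs (quotient_proj x) (quotient_proj @` A).
Proof.
rewrite nbhsE => -[B [oB Bx] BA]; apply: (filterS (image_subset _ BA)).
apply: open_nbhs_nbhs; split; last by exists x.
change (open (quotient_proj @^-1` (quotient_proj @` B))).
(* The saturation of an open set is the union of its translates by [S], so the projection is
   open. *)
have -> : quotient_proj @^-1` (quotient_proj @` B) =
    \bigcup_(s in [set` S]) ((fun x => x - s) @^-1` B).
  apply/seteqP; split=> y /=.
    move=> [b Bb /quotient_projE byS]; exists (y - b); last by rewrite /= subKr.
    by rewrite /= -opprB rpredN.
  move=> [s /= sS Bys]; exists (y - s) => //; apply/quotient_projE.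
  by rewrite addrAC subrr add0r rpredN.
by apply: bigcup_open => s _; apply: open_comp => // y _; exact: subr_continuous.
Qed.

(** If [quotient_proj x] lies in every neighborhood of 0, then [x] is arbitrarily close to [S],
    hence in [S]. *)
Lemma quotient_hausdorff : closed [set` S] -> hausdorff_space (quotient_group S).
Proof.
move=> cS; apply: hausdorff_nbhs0 => a; have [x <-] := quotient_proj_surj a.
move=> xA; apply/quotient_proj_eq0; apply: cS; apply/closureP_shift => B nB.
have [y By] : (quotient_proj @` [set y | B (- y)]) (quotient_proj x).
  apply: xA; rewrite -(raddf0 quotient_proj); apply: quotient_proj_nbhs.
  by apply: nbhs_preimage; [exact: opp_continuous|rewrite oppr0].
move=> /quotient_projE yxS; exists (x - y); first by rewrite /= -opprB rpredN.
by rewrite addrAC subrr add0r.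
Qed.
End Quotient.

Lemma nbhs_subgroup (V : topologicalZmodType) (S : zmodClosed V)
    (x : subgroup S) (U : set (subgroup S)) :
  nbhs x U <-> exists2 P, nbhs (\val x) P & \val @^-1` P `<=` U.
Proof.
rewrite nbhsE; split=> [[_ [[P oP <-] Px] PU]|[P]].
  by exists P => //; exact: open_nbhs_nbhs.
rewrite nbhsE => -[Q [oQ Qx] QP] PU; exists (\val @^-1` Q); last first.
  by apply: subset_trans PU => y /QP.
by split=> //; exists Q.
Qed.

(** * Local minimality versus local essentiality *)

Lemma locally_minimal_dense_essential (K : topologicalZmodType)
    (G : zmodClosed K) :
  hausdorff_space K -> dense [set` G] -> locally_minimal (subgroup G) ->
  locally_essential G.
Proof.
move=> hK dG [_ [V /nbhs_subgroup[P nP PV] minV]].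
have [B nB BP] := nbhs0_sub nP; exists B => // M cM MB GM.
pose f : {additive subgroup G -> quotient_group M} :=
  (quotient_proj M \o (val : subgroup G -> K)).
have fI : injective f.
  move=> x y /quotient_projE xyM; apply/val_inj/eqP.
  rewrite -subr_eq0; apply/eqP.
  suff : ([set` G] `&` [set` M]) (val x - val y) by rewrite GM.
  by split=> //=; apply: rpredB; exact: valP.
have fc : continuous f.
  move=> x; apply: continuous_comp; first exact: initial_continuous.
  exact: quotient_proj_continuous.
have eqs : (induced_topology f : set_system _) = open.
  apply: minV.
  - by move=> _ [Q oQ <-]; apply: open_comp => // x _; exact: fc.
  - exact: induced_group_topology.
  - by apply: induced_hausdorff => //; exact: quotient_hausdorff.
  - apply/nbhs_induced; exists (quotient_proj M @` B).
      by rewrite raddf0 -(raddf0 (quotient_proj M)); exact: quotient_proj_nbhs.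
    (* [b - g] lies in [M], hence in [B], so [g = b - (b - g)] lies in [P]. *)
    move=> g [b Bb /quotient_projE bgM]; apply: PV => /=.
    rewrite -[val g](subKr b); apply: BP => //; exact: MB.
apply/seteqP; split=> m /=; last by move=> ->; exact: rpred0.
(* It suffices that each neighborhood [A] of 0 meets each neighborhood [C] of [m]. The trace of [A]
   on [G] contains that of the preimage of an open [Q] around 0 in [K / M]. This preimage also
   contains [m], so density yields a point of [G] in it close to [m]. *)
move=> mM; apply/esym; apply: hK => A C nA; rewrite nbhsE => -[D [oD Dm] DC].
have : nbhs (0 : subgroup G) (val @^-1` A) by apply/nbhs_subgroup; exists A.
rewrite nbhsE => -[U [oU U0] UA]; move: oU; rewrite -eqs => -[Q oQ OU].
have [|| x [[Ox Dx] Gx]] := dG ((quotient_proj M @^-1` Q) `&` D).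
- exists m; split => //=; move: U0; rewrite -OU /= !raddf0.
  by move: mM => /quotient_proj_eq0 ->.
- apply: openI => //; apply: open_comp => // y _; exact: quotient_proj_continuous.
exists x; split; last exact: DC.
by apply: (UA (Sub x Gx : subgroup G)); rewrite -OU.
Qed.

Lemma essential_locally_minimal (K : topologicalZmodType) (G : zmodClosed K) :
  compact [set: K] -> hausdorff_space K -> locally_essential G ->
  locally_minimal (subgroup G).
Proof.
move=> cK hK [V nV essV].
have hG : hausdorff_space (subgroup G).
  move=> x y xy; apply: val_inj; apply: hK => A B nA nB.
  have [|| z [Az Bz]] := xy (val @^-1` A) (val @^-1` B).
  - by apply/nbhs_subgroup; exists A.
  - by apply/nbhs_subgroup; exists B.
  by exists (val z).
have [B nB BV] := nbhs0_sub nV.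
split=> //; exists (val @^-1` B); first by apply/nbhs_subgroup; exists B.
move=> sigma sub gs hs nsB.
pose L := topologicalZmod_of gs.
pose cl (U : set (subgroup G)) : set K := closure (val @` U).
pose A := \bigcap_(U in [set U : set L | nbhs 0 U]) cl U.
have A0 : A 0.
  move=> U nU; apply: subset_closure.
  by exists 0; [exact: (nbhs_singleton nU)|exact: raddf0].
have AB x y : A x -> A y -> A (x - y).
  move=> Ax Ay U /(@nbhs0_sub L)[U' nU' UU].
  apply/closureP_shift => C /nbhs0_sub[D nD DC].
  have /closureP_shift /(_ D nD)[_ [u U'u <-] Du] := Ax U' nU'.
  have /closureP_shift /(_ D nD)[_ [v U'v <-] Dv] := Ay U' nU'.
  exists (val (u - v)); first by exists (u - v) => //; exact: UU.
  by rewrite raddfB opprD addrACA -opprD; exact: DC.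
have clA : closed A by apply: closed_bigI => U _; exact: closed_closure.
have [M MA] := zmodClosed_of_set A0 AB.
have AV : A `<=` V.
  (* Both [g] and [g - x] lie in [B], so their difference [x] lies in [V]. *)
  move=> x /(_ _ nsB)/closureP_shift/(_ B nB)[_ [g Bg <-] Bgx].
  by rewrite -(subKr (val g) x); exact: BV.
have AE : A = [set 0].
  rewrite -MA; apply: essV; rewrite MA // => {M MA}.
  apply/seteqP; split=> [x [/= Gx Ax]|_ -> /=]; last by split=> //; exact: rpred0.
  (* As [sigma] is coarser than the topology of [G], a point [x] of [G] in [A] cannot be separated
     from 0 by [sigma]-neighborhoods. *)
  suff : (0 : with_topology sigma) = Sub x Gx by move/(congr1 val); rewrite SubK.
  apply: hs => U U' nU; rewrite nbhsE => -[W [oW Wx] WU'].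
  have : nbhs (Sub x Gx : subgroup G) W.
    by apply: open_nbhs_nbhs; split=> //; exact: sub.
  move=> /nbhs_subgroup[P]; rewrite SubK => nP PW.
  by have [_ [[g Ug <-] Pg]] := Ax U nU P nP; exists g; split=> //; apply/WU'/PW.
apply: group_topology_eq => // U /nbhs_subgroup[P nP PU].
rewrite /= in nP.
(* Otherwise the sets [cl W] minus [P] form a filter base in the compact [K]. A cluster point lies
   in [A], so it is 0, yet the neighborhood [P] of 0 misses all these sets. *)
apply: contrapT => nU.
have nPc W : nbhs (0 : L) W -> exists x, cl W x /\ ~ P x.
  move=> nW; apply: contrapT => clWP; apply: nU.
  apply: filterS nW => g Wg; apply: PU => /=.
  apply: contrapT => nPg; apply: clWP; exists (val g); split=> //.
  by apply: subset_closure; exists g.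
pose F := filter_from [set W : set L | nbhs 0 W] (fun W => cl W `&` ~` P).
have FF : ProperFilter F.
  apply: filter_from_proper; last by move=> W /nPc[x]; exists x.
  apply: filter_from_filter; first by exists setT; exact: filterT.
  move=> W W' nW nW'; exists (W `&` W'); first exact: filterI.
  by move=> x [clx nPx]; split; split=> //; apply: closure_subset clx;
    apply: image_subset => ? [].
have [|x [_ Fx]] := cK F FF; first exact: filterT.
have : A x.
  move=> W nW; apply: closed_closure => C nC.
  have [|y [[clWy _] Cy]] := Fx (cl W `&` ~` P) C _ nC; first by exists W.
  by exists y.
rewrite AE => x0; rewrite x0 in Fx.
have [|y [nPy Py]] := Fx (~` P) P _ nP; last exact: nPy Py.
by exists setT; [exact: filterT|move=> ? []].
Qed.

(** * The circle *)

Section Circle.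
Variable R : realType.
Implicit Types (s t : R) (x : circle R).

Definition circle_proj : {additive R -> circle R} := quotient_proj (@integers R).

Lemma circle_proj_eq0 t : circle_proj t = 0 <-> t \is a Num.int.
Proof. exact: quotient_proj_eq0. Qed.

Lemma real_nbhs0P (A : set R) :
  nbhs 0 A <-> exists2 e, 0 < e & forall t, `|t| < e -> A t.
Proof.
split=> [/nbhs_ballP[e /= e0 eA]|[e e0 eA]].
  by exists e => // t te; apply: eA; rewrite /ball /= sub0r normrN.
by apply/nbhs_ballP; exists e => //= t; rewrite /ball /= sub0r normrN; exact: eA.
Qed.

Lemma integer_norm_lt1 t : t \is a Num.int -> `|t| < 1 -> t = 0.
Proof.
move=> tZ; case: (eqVneq t 0) => // t0; rewrite ltNge.
by rewrite norm_intr_ge1.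
Qed.

(** At most one integer is within 1/2 of [t]; if such an integer [a] differed from [t], there would
    be another one closer to [t]. *)
Lemma closed_integers : closed [set` @integers R].
Proof.
move=> t /closureP_shift tZ.
have nball e : 0 < e -> nbhs (0 : R) [set s | `|s| < e].
  by move=> e0; apply/real_nbhs0P; exists e.
have [a /= aZ at2] := tZ _ (nball (2^-1) ltac:(lra)).
have [-> //|ta] := eqVneq t a.
have at0 : 0 < `|a - t| by rewrite normr_gt0 subr_eq0 eq_sym.
have [b /= bZ bt] := tZ _ (nball _ at0).
have ab : b - a = 0.
  apply: integer_norm_lt1; first exact: rpredB.
  move: at2 (lt_trans bt at2); rewrite !ltr_norml => /andP[? ?] /andP[? ?].
  by apply/andP; split; lra.
by move: bt; rewrite (subr0_eq ab) ltxx.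
Qed.

Lemma circle_hausdorff : hausdorff_space (circle R).
Proof. exact: quotient_hausdorff closed_integers. Qed.

(** The radius 1/4 makes lifts compatible with doubling: for [s] and [t] below it, [s - 2t] stays
    below 3/4 in absolute value, so it vanishes when it is an integer. *)
Definition circle_arc : set (circle R) := circle_proj @` [set t | `|t| < 4^-1].

Lemma nbhs_circle_arc : nbhs 0 circle_arc.
Proof.
rewrite -(raddf0 circle_proj); apply: quotient_proj_nbhs; apply/real_nbhs0P.
by exists 4^-1 => //; lra.
Qed.

Lemma circle_arc_double s t : `|s| < 4^-1 -> `|t| < 4^-1 ->
  circle_proj s = circle_proj (t *+ 2) -> s = t *+ 2.
Proof.
move=> s4 t4 /quotient_projE st; apply/eqP; rewrite -subr_eq0; apply/eqP.
apply: integer_norm_lt1 => //; move: s4 t4; rewrite !ltr_norml mulr2n.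
by move=> /andP[? ?] /andP[? ?]; apply/andP; split; lra.
Qed.

(** By induction [2^n t] is the small lift of [2^n x], so it stays bounded by 1/4 for all [n], which
    forces [t = 0]. *)
Lemma circle_no_small_subgroup x : (forall n, circle_arc (x *+ n)) -> x = 0.
Proof.
move=> xarc; have [t t4 tx] := xarc 1%N; rewrite mulr1n in tx.
have t4n n : `|t *+ (2 ^ n)| < 4^-1.
  elim: n => [|n IH]; first by rewrite mulr1n.
  have [s s4 sx] := xarc (2 ^ n.+1)%N.
  rewrite expnSr mulrnA -(circle_arc_double s4 IH) //.
  by rewrite sx -tx -raddfMn expnSr mulrnA.
have [t0|t0] := eqVneq t 0; first by rewrite -tx t0 raddf0.
have t0' : 0 < `|t| by rewrite normr_gt0.
(* For this exponent [n], [2^n] exceeds [1/|t|], so [2^n |t|] exceeds 1. *)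
have := t4n (Num.bound `|t|^-1); have := @upper_nthrootP R `|t|^-1 _ (leqnn _).
rewrite -(mulr_natr t) normrM natrX normrX normr_nat => lt1 lt2.
have := ltr_pM2l t0' (`|t|^-1) (2 ^+ Num.bound `|t|^-1).
rewrite lt1 mulfV ?gt_eqF // => lt3; suff : false by [].
move: (lt_trans lt3 lt2); lra.
Qed.

End Circle.

(** * Closed subgroups of the real line *)

Section RealSubgroups.
Variables (R : realType) (S : zmodClosed R).

Lemma subgroup_real_mod (h t : R) : 0 < h ->
  exists2 k : int, 0 <= t - h *~ k & t - h *~ k < h.
Proof.
move=> h0; exists (Num.floor (t / h)); have /andP[] := floor_itv (t / h);
  rewrite intrD ler_pdivlMr // ltr_pdivrMr // mulrDl mul1r !mulrzl; lra.
Qed.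

Lemma closed_subgroup_real_dense : closed [set` S] ->
  (forall e : R, 0 < e -> exists2 h, h \in S & 0 < h < e) -> forall t, t \in S.
Proof.
move=> cS Se t; apply: cS; apply/closureP_shift => B /real_nbhs0P[e e0 eB].
have [h hS /andP[h0 he]] := Se e e0.
have [k k0 kh] := subgroup_real_mod t h0.
exists (h *~ k); first exact: rpredMz.
apply: eB; rewrite distrC ger0_norm //; exact: lt_trans he.
Qed.

(** Without arbitrarily small positive elements, [S] consists of the multiples of its least positive
    element [h]. Since 1 is some [m h], multiplication by [m] sends [S] into the integers. *)
Lemma closed_subgroup_real : closed [set` S] -> 1 \in S ->
  (forall t, t \in S) \/
  exists2 m, (0 < m)%N & forall t, t \in S -> t *+ m \is a Num.int.
Proof.
move=> cS S1.
have [Se|] := pselect (forall e : R, 0 < e -> exists2 h, h \in S & 0 < h < e).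
  by left; exact: closed_subgroup_real_dense.
move=> /existsNP[e /not_implyP[e0 Se]]; right.
pose P := [set h : R | h \in S /\ 0 < h].
have infP : has_inf P.
  by split; [exists 1|exists 0 => h [_ /ltW]].
(* [S] has no element strictly between 0 and [e]. As [h] is within [e] of the infimum, a smaller
   positive [h'] in [S] would put [h - h'] there; so [h] is least. *)
have [h [hS h0] hinf] := inf_adherent e0 infP.
have hmin h' : h' \in S -> 0 <= h' -> h' < h -> h' = 0.
  move=> h'S; rewrite le_eqVlt => /predU1P[//|h'0] h'h; exfalso; apply: Se.
  exists (h - h'); first exact: rpredB.
  have : inf P <= h' by apply: ge_inf; [exact: infP.2|].
  by move=> ?; apply/andP; split; lra.
have hmul t : t \in S -> exists k : int, t = h *~ k.
  move=> tS; have [k k0 kh] := subgroup_real_mod t h0; exists k.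
  by apply/eqP; rewrite -subr_eq0; apply/eqP/hmin => //; rewrite rpredB ?rpredMz.
have [m hm] := hmul 1 S1.
have m0 : 0 < m by rewrite -(@ltr0z R) -(pmulr_rgt0 _ h0) mulrzr -hm.
exists `|m|%N; first by rewrite absz_gt0 gt_eqF.
move=> t /hmul[k ->]; rewrite pmulrn gtz0_abs //.
by rewrite mulrzAC -hm; apply/intrP; exists k.
Qed.

End RealSubgroups.

(** * Continuous endomorphisms of the circle *)

Section CircleHom.
Variable R : realType.

Lemma dyadic_small (e : R) : 0 < e -> exists N, 2 ^- N < e.
Proof.
move=> e0; have := @upper_nthrootP R e^-1 _ (leqnn _).
exists (Num.bound e^-1).
by rewrite -[ltRHS]invrK ltf_pV2 ?posrE ?invr_gt0 ?exprn_gt0.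
Qed.

(* Halving the argument halves the small lift, so [f] agrees with
   [t |-> circle_proj (a * t)] on all small dyadic numbers, hence everywhere. *)
Lemma real_circle_hom (f : {additive R -> circle R}) :
  continuous f -> exists a : R, forall t, f t = circle_proj R (a * t).
Proof.
move=> fc.
have : nbhs (0 : R) (f @^-1` @circle_arc R).
  by apply: nbhs_preimage => //; rewrite raddf0; exact: nbhs_circle_arc.
move=> /real_nbhs0P[e e0 earc].
have [N Ne] := dyadic_small e0.
(* Starting at [N], these dyadics lie where [f] takes values in the arc, so each [f (u n)] has a
   lift [s n] below 1/4. *)
pose u n : R := 2 ^- (N + n).
have u0 n : 0 < u n by rewrite invr_gt0 exprn_gt0.
have uS n : u n.+1 *+ 2 = u n.
  by rewrite /u addnS exprS invfM mulr2n; set x := 2 ^- (N + n); lra.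
have ue n : u n < e.
  apply: le_lt_trans Ne; rewrite lef_pV2 ?posrE ?exprn_gt0 //.
  by rewrite ler_eXn2l ?leq_addr // ltr1n.
have /choice[s sP] n : exists s, `|s| < 4^-1 /\ circle_proj R s = f (u n).
  by have [|s s4 su] := earc (u n); [rewrite ger0_norm ?ltW|exists s].
have sS n : s n = s n.+1 *+ 2.
  have [[s4 su] [s4' su']] := (sP n, sP n.+1); apply: circle_arc_double => //.
  by rewrite raddfMn su su' -raddfMn uS.
pose a := s 0%N / u 0%N; exists a.
have sa n : s n = a * u n.
  elim: n => [|n IH]; first by rewrite /a divfK // gt_eqF.
  by move: IH; rewrite sS -(uS n) !mulr2n; lra.
pose g : R -> circle R := fun t => f t - circle_proj R (a * t).
have gB : {morph g : x y / x - y}.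
  by move=> x y; rewrite /g mulrBr !raddfB addrACA.
have gc : continuous g.
  apply: continuous_sub => // t; apply: continuous_comp; last first.
    exact: quotient_proj_continuous.
  exact: mulrl_continuous.
have g0 : g 0 = 0 by rewrite /g mulr0 !raddf0 addr0.
have [S SE] : exists S : zmodClosed R, [set` S] = g @^-1` [set 0].
  by apply: zmodClosed_of_set => [|x y gx gy]; rewrite /= ?gB ?gx ?gy ?subr0.
have cS : closed [set` S].
  rewrite SE; apply: preimage_closed => [t _|]; first exact: gc.
  exact: compact_closed (@circle_hausdorff R) (@compact_set1 _ 0).
have Sall : forall t, t \in S.
  apply: closed_subgroup_real_dense => // e' e'0.
  have [n ne] := dyadic_small e'0.
  exists (u n).
    have : (g @^-1` [set 0]) (u n) by rewrite /= /g -sa (sP n).2 subrr.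
    by rewrite -SE.
  rewrite u0 (le_lt_trans _ ne) // lef_pV2 ?posrE ?exprn_gt0 //.
  by rewrite ler_eXn2l ?leq_addl // ltr1n.
move=> t; have : [set` S] t by exact: Sall.
by rewrite SE => /eqP; rewrite subr_eq0 => /eqP.
Qed.

(** Pulled back to the line, [f] is multiplication by some [a], an integer because 1 is sent to
    0. *)
Lemma circle_endomorphism (f : {additive circle R -> circle R}) :
  continuous f -> exists k : int, forall x, f x = x *~ k.
Proof.
move=> fc; pose h : {additive R -> circle R} := (f \o circle_proj R).
have [t|a ha] := @real_circle_hom h.
  by apply: continuous_comp; [exact: quotient_proj_continuous|exact: fc].
have /intrP[k ak] : a \is a Num.int.
  apply/circle_proj_eq0; rewrite -(mulr1 a) -ha /h /=.
  by have /circle_proj_eq0 -> : 1 \is a @Num.int R by []; rewrite raddf0.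
exists k => x; have [t <-] := quotient_proj_surj x.
change (f (circle_proj R t) = circle_proj R t *~ k).
by rewrite -raddfMz -[LHS]/(h t) ha ak mulrzl.
Qed.

End CircleHom.

(** * Factorization through compact groups, and tori *)

Lemma additive_of (V W : zmodType) (f : V -> W) :
  {morph f : x y / x - y} -> exists g : {additive V -> W}, g =1 f.
Proof.
move=> fB; have fz : zmod_morphism f by move=> x y; exact: fB.
pose g : {additive V -> W} := HB.pack f (GRing.isZmodMorphism.Build V W f fz).
by exists g.
Qed.

(* A continuous surjection from a compact space onto a Hausdorff space is a
   quotient map. *)
Lemma compact_factor (K A B : topologicalZmodType) (L : set K)
    (p : {additive K -> A}) (q : {additive K -> B}) :
  compact [set: K] -> hausdorff_space A -> closed L ->
  (forall x y, L x -> L y -> L (x - y)) ->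
  continuous p -> continuous q -> (forall a, exists2 x, L x & p x = a) ->
  (forall x, L x -> p x = 0 -> q x = 0) ->
  exists g : {additive A -> B}, continuous g /\ forall x, L x -> g (p x) = q x.
Proof.
move=> cK hA cL LB pc qc psurj pq.
have /choice[X XP] a : exists x, L x /\ p x = a.
  by have [x] := psurj a; exists x.
have gp x : L x -> q (X (p x)) = q x.
  move=> Lx; have [LX pX] := XP (p x); apply/eqP; rewrite -subr_eq0 -raddfB.
  by apply/eqP/pq; [exact: LB|rewrite raddfB pX subrr].
have gB : {morph q \o X : a b / a - b}.
  move=> a b /=; have [[LXa pXa] [LXb pXb]] := (XP a, XP b).
  by rewrite -raddfB -(gp (X a - X b)) ?raddfB ?pXa ?pXb //; exact: LB.
have [g gE] := additive_of gB; exists g.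
split; last by move=> x Lx; rewrite gE /= gp.
apply/continuous_closedP => C cC.
(* The right-hand side is the image of a compact set, hence closed. *)
have -> : g @^-1` C = p @` (L `&` q @^-1` C).
  apply/seteqP; split=> [a|_ [x [Lx Cx] <-]]; rewrite /preimage /= gE /= ?gp //.
  by have [LX pX] := XP a => Ca; exists (X a).
apply: compact_closed => //; apply: continuous_compact.
  exact: continuous_subspaceT.
apply: (subclosed_compact _ cK) => //; apply: closedI => //.
by apply: preimage_closed => // x _; exact: qc.
Qed.

(** * Topology of the torus *)

Section Torus.
Variables (R : realType) (d : nat).

Lemma torus_coord_continuous i : continuous (fun y : torus R d => y 0 i).
Proof.
move=> y A nA; exists (fun _ j => if j == i then A else setT) => [k j|z /(_ 0 i)].
  by case: eqP => [->|_]; [rewrite (ord1 k)|exact: filterT].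
by rewrite eqxx.
Qed.

Lemma continuous_to_torus (T : topologicalType) (f : T -> torus R d) :
  (forall i, continuous (fun x => f x 0 i)) -> continuous f.
Proof.
move=> fc x A [P nP PA].
have : nbhs x [set z | forall i, P 0 i (f z 0 i)].
  by apply: filter_forall => i; exact: fc.
by apply: filterS => z Pz; apply: PA => k j; rewrite (ord1 k).
Qed.

Lemma torus_hausdorff : hausdorff_space (torus R d).
Proof.
apply: hausdorff_nbhs0 => y yA; apply/rowP => i; rewrite mxE.
have := @circle_hausdorff R; move=> hR; apply/esym/hR => A B nA nB.
exists (y 0 i); split; last exact: nbhs_singleton.
apply: (yA [set z | A (z 0 i)]).
apply: (@nbhs_preimage _ _ (fun z : torus R d => z 0 i)).
  exact: torus_coord_continuous.
by rewrite mxE.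
Qed.

Lemma torus_no_small_subgroup :
  exists2 U : set (torus R d), nbhs 0 U &
    forall y, (forall n, U (y *+ n)) -> y = 0.
Proof.
exists [set y | forall i, circle_arc (y 0 i)].
  have := @filter_forall _ _ (fun i => [set y : torus R d | circle_arc (y 0 i)])
    (nbhs (0 : torus R d)) _.
  apply=> i; apply: (@nbhs_preimage _ _ (fun z : torus R d => z 0 i)).
    exact: torus_coord_continuous.
  by rewrite mxE; exact: nbhs_circle_arc.
move=> y yU; apply/rowP => i; rewrite mxE; apply: circle_no_small_subgroup => n.
by have := yU n i; rewrite mulmxnE.
Qed.

End Torus.

(** * Local essentiality in [K] and in [N] *)

Section LocallyEssential.
Variables (K : topologicalZmodType) (G N : zmodClosed K).

(** A closed subgroup of [N] is closed in [K] because [N] is, so the neighborhood that serves [G] in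
    [K] serves its trace in [N]. *)
Lemma trace_locally_essential :
  closed [set` N] -> locally_essential G -> locally_essential (trace G N).
Proof.
move=> cN [V nV Vess].
exists (\val @^-1` V); first by apply/nbhs_subgroup; exists V => //; rewrite raddf0.
move=> M cM MV GM.
have [||M' M'E] := @zmodClosed_of_set K (\val @` [set` M]).
- by exists 0; [exact: rpred0|rewrite raddf0].
- move=> _ _ [x xM <-] [y yM <-]; exists (x - y); last by rewrite raddfB.
  exact: rpredB.
have M'0 : [set` M'] = [set 0].
  apply: Vess; rewrite M'E.
  - move=> x clx; have xN : x \in N.
      apply: cN => B /clx[_ [[y yM <-] By]].
      by exists (\val y); split=> //; exact: valP.
    exists (Sub x xN); last by rewrite SubK.
    apply: cM => B /nbhs_subgroup[P]; rewrite SubK => nP PB.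
    by have [_ [[y yM <-] Py]] := clx P nP; exists y; split=> //; exact: PB.
  - by move=> _ [x xM <-]; exact: MV.
  - apply/seteqP; split=> [y [Gy [x xM xy]]|_ ->].
      have : ([set` trace G N] `&` [set` M]) x by split=> //; rewrite -xy in Gy.
      by rewrite GM -xy => ->; exact: raddf0.
    by split; [exact: rpred0|exists 0; [exact: rpred0|rewrite raddf0]].
apply/seteqP; split=> [x xM|_ ->]; last exact: rpred0.
have : [set` M'] (\val x) by rewrite M'E; exists x.
by rewrite M'0 => x0; apply: val_inj; rewrite raddf0; exact: x0.
Qed.

Lemma locally_essential_of_trace (R : realType) (d : nat) :
  topologically_isomorphic (quotient_group N) (torus R d) ->
  locally_essential (trace G N) -> locally_essential G.
Proof.
move=> [f [g [fK _ fc _]]] [V /nbhs_subgroup[P nP PV] Vess].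
have [U nU U0] := torus_no_small_subgroup R d.
rewrite raddf0 in nP.
pose h : {additive K -> torus R d} := (f \o quotient_proj N).
have hc : continuous h.
  move=> x; apply: continuous_comp; [exact: quotient_proj_continuous|exact: fc].
exists (P `&` h @^-1` U).
  by apply: filterI => //; apply: nbhs_preimage => //; rewrite raddf0.
move=> M cM MPU GM.
(* The image of [M] in the torus is a subgroup inside [U], hence trivial. *)
have MN x : x \in M -> x \in N.
  move=> xM; apply/quotient_proj_eq0; apply: (can_inj fK); rewrite raddf0.
  apply: U0 => n; rewrite -[f _]/(h x) -raddfMn.
  by have [] := MPU (x *+ n) (rpredMn n xM).
(* As [M] lies in [N], [trace M N] is [M] itself seen in [N]. *)
have M'0 : [set` trace M N] = [set 0].
  apply: Vess.
  - change (closed ((\val : subgroup N -> K) @^-1` [set` M])).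
    apply: preimage_closed => // x _; exact: initial_continuous.
  - by move=> x xM; apply: PV; have [] := MPU (\val x) xM.
  - apply/seteqP; split=> [x [Gx Mx]|_ ->]; last by split; exact: rpred0.
    have : ([set` G] `&` [set` M]) (\val x) by split.
    by rewrite GM => x0; apply: val_inj; rewrite raddf0; exact: x0.
apply/seteqP; split=> [x xM|_ ->]; last exact: rpred0.
have : [set` trace M N] (Sub x (MN x xM)) by [].
by rewrite M'0 /= => /(congr1 val); rewrite SubK raddf0.
Qed.

End LocallyEssential.

(** * Characters *)

Section Characters.
Variables (R : realType) (K : topologicalZmodType).

Lemma character_morphism (chi : dual R K) : zmod_morphism (\val chi).
Proof. by have /asboolP[] := valP chi. Qed.

Definition character_fun (chi : dual R K) : {additive K -> circle R} :=
  HB.pack (\val chi)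
    (GRing.isZmodMorphism.Build K (circle R) (\val chi) (character_morphism chi)).

Lemma character_fun_continuous chi : continuous (character_fun chi).
Proof. by have /asboolP[] := valP chi. Qed.

Lemma character_fun_mulrn chi n x :
  character_fun (chi *+ n) x = character_fun chi x *+ n.
Proof. by elim: n => // n IH; rewrite !mulrS -IH. Qed.

Lemma character_sum_eq0 n (chi : 'I_n -> dual R K) (c : 'I_n -> int) :
  (forall x, \sum_i character_fun (chi i) x *~ c i = 0) ->
  \sum_i chi i *~ c i = 0.
Proof.
move=> chi0; apply: val_inj; rewrite raddf_sum raddf0; apply/funext => x.
rewrite fct_sumE -[RHS](chi0 x); apply: eq_bigr => i _.
case: (c i) => k; rewrite ?NegzE ?mulrNz -!pmulrn -character_fun_mulrn //.
Qed.

Lemma zindependent_lift n (A : zmodType) (e : 'I_n.+1 -> A) :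
  zindependent e -> zindependent (e \o lift ord0).
Proof.
move=> ind c ce0 i.
(* The coefficient 0 at [ord0] extends a relation among the other elements. *)
pose c' j := if unlift ord0 j is Some k then c k else 0.
have := ind c' _ (lift ord0 i); rewrite /c' liftK; apply.
rewrite big_ord_recl /= unlift_none mulr0z add0r -[RHS]ce0.
by apply: eq_bigr => j _; rewrite liftK.
Qed.

Lemma independent_characters_surjective n (chi : 'I_n -> dual R K) :
  compact [set: K] -> zindependent chi ->
  forall y : 'I_n -> circle R, exists x, forall i, character_fun (chi i) x = y i.
Proof.
move=> cK; elim: n chi => [|n IH] chi ind y; first by exists 0 => -[].
pose phi := character_fun (chi ord0).
pose psi i := character_fun (chi (lift ord0 i)).
have psurj z : exists x, forall i, psi i x = z i := IH _ (zindependent_lift ind) z.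
pose L (J : pred 'I_n) := [set x : K | forall i, J i -> psi i x = 0].
have LB J x y' : L J x -> L J y' -> L J (x - y').
  by move=> Lx Ly i Ji; rewrite raddfB Lx // Ly // subr0.
have cL J : closed (L J).
  have -> : L J = \bigcap_(i in [set i | J i]) (psi i @^-1` [set 0]) by [].
  apply: closed_bigI => i _; apply: preimage_closed.
    by move=> x _; exact: character_fun_continuous.
  exact: compact_closed (@circle_hausdorff R) (@compact_set1 _ 0).
pose F := phi @` L predT.
have [||S SE] := @zmodClosed_of_set R (circle_proj R @^-1` F).
- by exists 0; [move=> i _; rewrite raddf0|rewrite !raddf0].
- move=> s t [x Lx xs] [z Lz zt]; exists (x - z); first exact: LB.
  rewrite [phi _]raddfB xs zt; exact/esym/raddfB.
have cS : closed [set` S].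
  rewrite SE; apply: preimage_closed => [t _|]; first exact: quotient_proj_continuous.
  apply: compact_closed; first exact: circle_hausdorff.
  apply: continuous_compact.
    exact: continuous_subspaceT (@character_fun_continuous _).
  exact: (subclosed_compact _ cK).
have S1 : 1 \in S.
  have : (circle_proj R @^-1` F) 1.
    exists 0; first by move=> i _; rewrite raddf0.
    by rewrite raddf0; apply/esym/circle_proj_eq0.
  by rewrite -SE.
have [Sall|[m m0 Sm]] := closed_subgroup_real cS S1.
  (* Here [phi] maps the common kernel onto the circle, so a preimage [x] of the other coordinates
     is corrected by some [z] of that kernel. *)
  have [x xy] := psurj (y \o lift ord0).
  have [t ty] := quotient_proj_surj (y ord0 - phi x).
  have : [set` S] t by exact: Sall.
  rewrite SE => -[z Lz zt]; exists (x + z) => i; rewrite raddfD.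
  case: (unliftP ord0 i) => [j ->|->].
    by rewrite -/(psi j) (xy j) (Lz j) ?addr0.
  rewrite -/phi zt; have -> : circle_proj R t = y ord0 - phi x by exact: ty.
  by rewrite addrC subrK.
have phim x : L predT x -> phi x *+ m = 0.
  move=> Lx; have [t tx] := quotient_proj_surj (phi x).
  have tS : t \in S.
    have : (circle_proj R @^-1` F) t by exists x.
    by rewrite -SE.
  have <- : circle_proj R t = phi x by exact: tx.
  by rewrite -raddfMn; apply/circle_proj_eq0; exact: Sm.
(* The factorization goes one coordinate at a time: [psi j] maps [Lj j] onto the circle with kernel
   [L predT], which [m phi] kills. So [m phi] is an integer multiple of [psi j] on [Lj j]. *)
pose Lj j := L [pred i | i != j].
pose q := character_fun (chi ord0 *+ m).
have qE x : q x = phi x *+ m by exact: character_fun_mulrn.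
have /choice[k kE] j : exists k : int,
    forall x, Lj j x -> psi j x *~ k = phi x *+ m.
  have [|||||z|x Lx xj|g [gc gE]] :=
    @compact_factor K (circle R) (circle R) (Lj j) (psi j) q cK.
  - exact: circle_hausdorff.
  - exact: cL.
  - exact: LB.
  - exact: character_fun_continuous.
  - exact: character_fun_continuous.
  - have [x xz] := psurj (fun i => if i == j then z else 0).
    exists x; last by rewrite xz eqxx.
    by move=> i /negbTE ij; rewrite xz ij.
  - rewrite qE; apply: phim => i _; have [->//|ij] := eqVneq i j; exact: Lx.
  have [k gk] := circle_endomorphism gc; exists k => x Lx.
  by rewrite -gk gE // qE.
(* Coefficients of the relation [m phi = sum_j k_j psi_j], nontrivial since [m] is positive. *)
pose c i := if unlift ord0 i is Some j then - k j else m%:Z.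
suff : c ord0 = 0 by rewrite /c unlift_none => -[m00]; rewrite m00 in m0.
apply: ind; apply: character_sum_eq0 => x.
rewrite big_ord_recl /c unlift_none.
(* [X j] carries the [j]-th coordinate of [x] and is 0 at the others, so [x - sum_j X j] lies in the
   common kernel. *)
have /choice[X XE] j : exists z, Lj j z /\ psi j z = psi j x.
  have [z zE] := psurj (fun i => if i == j then psi j x else 0).
  exists z; rewrite zE eqxx; split=> // i /negbTE ij; by rewrite zE ij.
have Lx : L predT (x - \sum_j X j).
  move=> i _; rewrite raddfB raddf_sum (bigD1 i) // big1 => [|j ji].
    by rewrite (XE i).2 [X in _ - X]addr0 subrr.
  by apply: (XE j).1; rewrite /= eq_sym.
have := phim _ Lx; rewrite -qE raddfB raddf_sum => /eqP.
rewrite subr_eq0 => /eqP qx.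
rewrite -pmulrn -/phi -qE qx -big_split big1 // => j _.
by rewrite liftK mulrNz -/(psi j) -(XE j).2 (kE j _ (XE j).1) qE; exact: subrr.
Qed.

(** [N] is the kernel of the map to the torus given by [d] independent characters. Both [K / N] and
    the torus are Hausdorff quotients of the compact [K] with this kernel, so [compact_factor] gives
    mutually inverse continuous maps. *)
Lemma torus_quotient_exists (d : nat) :
  compact [set: K] -> hausdorff_space K -> has_dim R K d ->
  exists N, torus_quotient_subgroups R K d N.
Proof.
move=> cK hK [[chi ind] _].
have surj := independent_characters_surjective cK ind.
have [|p pE] := @additive_of K (torus R d)
  (fun x => \row_i character_fun (chi i) x).
  by move=> x y; apply/rowP => i; rewrite !mxE raddfB.
have pc : continuous p.
  apply: continuous_to_torus => i.
  have -> : (fun x => p x 0 i) = character_fun (chi i).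
    by apply/funext => x; rewrite pE mxE.
  exact: character_fun_continuous.
have hT := @torus_hausdorff R d.
have psurj y : exists2 x, [set: K] x & p x = y.
  by have [x xy] := surj (y 0); exists x => //; apply/rowP => i; rewrite pE mxE.
have [|x y px py|N NE] := @zmodClosed_of_set K (p @^-1` [set 0]).
- exact: raddf0.
- by rewrite /= raddfB px py subr0.
have pN x : p x = 0 <-> x \in N.
  by have -> : (p x = 0) = [set` N] x by rewrite NE.
have cN : closed [set` N].
  rewrite NE; apply: preimage_closed => [x _|]; first exact: pc.
  exact: compact_closed hT (@compact_set1 _ 0).
exists N; split=> //.
have qc := @quotient_proj_continuous K N.
have [|||f [fc fE]] := @compact_factor K _ _ setT (quotient_proj N) p
  cK (quotient_hausdorff cN) closedT _ qc pc.
- by [].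
- by move=> a; have [x] := quotient_proj_surj a; exists x.
- by move=> x _ /quotient_proj_eq0/pN.
have [||g [gc gE]] := @compact_factor K _ _ setT p (quotient_proj N)
  cK hT closedT _ pc qc psurj.
- by [].
- by move=> x _ /pN/quotient_proj_eq0.
exists f, g; split=> // [a|y].
  by have [x <-] := quotient_proj_surj a; rewrite fE // gE.
by have [x _ <-] := psurj y; rewrite gE // fE.
Qed.

End Characters.

(** * The equivalence of (a), (b) and (c) *)

Theorem proposition3p15 (R : realType) (K : topologicalZmodType) (d : nat)
    (G : zmodClosed K) :
  compact [set: K] -> hausdorff_space K -> has_dim R K d ->
  dense [set` G] ->
  (locally_minimal (subgroup G) <->
     exists2 N : zmodClosed K, torus_quotient_subgroups R K d N &
       locally_essential (trace G N)) /\
  (locally_minimal (subgroup G) <->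
     forall N : zmodClosed K, torus_quotient_subgroups R K d N ->
       locally_essential (trace G N)).
Proof.
move=> cK hK dimK dG.
(* This member of the family serves as witness for (b) and as the instance at which (c) is
   applied. *)
have [N0 N0P] := torus_quotient_exists cK hK dimK.
have ac : locally_minimal (subgroup G) -> forall N : zmodClosed K,
    torus_quotient_subgroups R K d N -> locally_essential (trace G N).
  move=> minG N [cN _]; apply: trace_locally_essential => //.
  exact: locally_minimal_dense_essential.
have ba : (exists2 N : zmodClosed K, torus_quotient_subgroups R K d N &
    locally_essential (trace G N)) -> locally_minimal (subgroup G).
  move=> [N [_ isoN] essN]; apply: essential_locally_minimal => //.
  exact: locally_essential_of_trace isoN essN.
split; split=> //.
  by move=> minG; exists N0 => //; exact: ac.
by move=> c; apply: ba; exists N0 => //; exact: c.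
Qed.
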